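(* Let $L$ be a non-trivial pseudocomplemented de Morgan algebra with dual $pm$-space $P$. Then $L\in\mathbf{M}_1$ if and only if, for every order component $Q$ of $P$, the subspace $Q\cup\zeta(Q)$ (with induced order, involution and topology) is isomorphic to one of $Q_0,Q_1,Q_2,Q_3,Q_4,Q_5$, or to $Q_6(I,S)$ for some Stone space $S$ with $|S|\ge 3$ and some set $I$ of isolated points of $S$.
   Context: $\mathbf{M}_1$ is the variety of pseudocomplemented de Morgan algebras $(L;\wedge,\vee,{}^\ast,{}^\prime,0,1)$ (bounded distributive lattice, pseudocomplement ${}^\ast$, de Morgan involution ${}^\prime$) satisfying $x\wedge x^{\prime\ast\prime}\le y\vee y^\ast$ and $(x\wedge x^{\prime\ast})^{\prime\ast}=(x\wedge x^{\prime\ast})^{\prime\ast\prime\ast}$. The dual $pm$-space is the Priestley space $(P;\tau,\le)$ of prime ideals with involution $\zeta(I)=\{a:a'\notin I\}$. An order component is a maximal subset of $P$ connected in the comparability graph of $(P;\le)$. The finite ordered sets with involution $\zeta$ (discrete topology; only the listed strict comparabilities hold): $Q_0=\{x\}$ with $\zeta(x)=x$; $Q_1=\{x,\zeta(x)\}$ incomparable; $Q_2=\{x<\zeta(x)\}$; $Q_3=\{x,y,\zeta(x),\zeta(y)\}$ with $x<\zeta(y)$, $y<\zeta(x)$; $Q_4=\{x,y,\zeta(x),\zeta(y)\}$ with $x<\zeta(y)$, $y<\zeta(y)$, $y<\zeta(x)$; $Q_5=\{x,y,\zeta(x),\zeta(y)\}$ with $x<\zeta(x)$, $x<\zeta(y)$,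 $y<\zeta(x)$, $y<\zeta(y)$. For a Stone space $S$ with $|S|\ge3$ and a set $I$ of isolated points of $S$, $Q_6(I,S)$ is $S\cup\zeta(S)$ where $\zeta(S)$ is a disjoint homeomorphic copy of $S$, with the disjoint union topology, $\zeta$ the involution interchanging $s\in S$ and its copy $\zeta(s)$, and the partial order generated by: for $x,y\in S$, $x<\zeta(y)$ iff ($x\ne y$ or $x\notin I$) (no other strict comparabilities). *)

(* Defs.v *)
From Stdlib Require Import Relations List.

Set Implicit Arguments.

Record pmAlg := PmAlg {
  car :> Type;
  meet : car -> car -> car;
  join : car -> car -> car;
  pc : car -> car;
  dm : car -> car;
  bot : car;
  top : car;
  meetC : forall a b, meet a b = meet b a;
  joinC : forall a b, join a b = join b a;
  meetA : forall a b c, meet a (meet b c) = meet (meet a b) c;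
  joinA : forall a b c, join a (join b c) = join (join a b) c;
  meet_absorb : forall a b, meet a (join a b) = a;
  join_absorb : forall a b, join a (meet a b) = a;
  distr : forall a b c, meet a (join b c) = join (meet a b) (meet a c);
  meet_top : forall a, meet a top = a;
  join_bot : forall a, join a bot = a;
  pc_spec : forall a x, meet x a = bot <-> meet x (pc a) = x;
  dm_invol : forall a, dm (dm a) = a;
  dm_join : forall a b, dm (join a b) = meet (dm a) (dm b)
}.
Arguments meet {p}. Arguments join {p}. Arguments pc {p}. Arguments dm {p}.

Definition leA {L : pmAlg} (a b : L) : Prop := meet a b = a.

Definition nontrivial (L : pmAlg) : Prop := bot L <> top L.

Definition inM1 (L : pmAlg) : Prop :=
  (forall x y : L,
     leA (meet x (dm (pc (dm x)))) (join y (pc y))) /\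
  (forall x : L,
     let w := meet x (pc (dm x)) in
     pc (dm w) = pc (dm (pc (dm w)))).

Definition prime_ideal {L : pmAlg} (I : L -> Prop) : Prop :=
  I (bot L) /\
  (forall a b, leA a b -> I b -> I a) /\
  (forall a b, I a -> I b -> I (join a b)) /\
  ~ I (top L) /\
  (forall a b, I (meet a b) -> I a \/ I b).

Definition leP {L : pmAlg} (I J : L -> Prop) : Prop := forall a, I a -> J a.

Definition zeta {L : pmAlg} (I : L -> Prop) : L -> Prop := fun a => ~ I (dm a).

Definition subbasic {L : pmAlg} (B : (L -> Prop) -> Prop) : Prop :=
  exists a : L, (B = fun I => ~ I a) \/ (B = fun I => I a).

Definition openP {L : pmAlg} (V : (L -> Prop) -> Prop) : Prop :=
  forall I, prime_ideal I -> V I ->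
    exists l : list ((L -> Prop) -> Prop),
      Forall (@subbasic L) l /\ Forall (fun B => B I) l /\
      (forall J, prime_ideal J -> Forall (fun B => B J) l -> V J).

Definition comparableP {L : pmAlg} (I J : L -> Prop) : Prop :=
  leP I J \/ leP J I.

Definition connectedP {L : pmAlg} (C : (L -> Prop) -> Prop) : Prop :=
  (forall I, C I -> prime_ideal I) /\
  forall I J, C I -> C J ->
    clos_refl_trans _ (fun X Y => C X /\ C Y /\ comparableP X Y) I J.

Definition order_component {L : pmAlg} (C : (L -> Prop) -> Prop) : Prop :=
  connectedP C /\
  forall D, connectedP D -> (forall I, C I -> D I) -> forall I, D I -> C I.

Record ostr := Ostr {
  ocar : Type;
  ole : ocar -> ocar -> Prop;
  oinv : ocar -> ocar;
  oopen : (ocar -> Prop) -> Prop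
}.

Definition iso_to {L : pmAlg} (Q : (L -> Prop) -> Prop) (M : ostr) : Prop :=
  let S := fun I => Q I \/ Q (zeta I) in
  exists f : (L -> Prop) -> ocar M,
    (forall I J, S I -> S J -> f I = f J -> I = J) /\
    (forall m, exists I, S I /\ f I = m) /\
    (forall I J, S I -> S J -> (leP I J <-> ole M (f I) (f J))) /\
    (forall I, S I -> f (zeta I) = oinv M (f I)) /\
    (forall U, oopen M U <->
       exists V, openP V /\ forall I, S I -> (V I <-> U (f I))).

Definition discrete (T : Type) : (T -> Prop) -> Prop := fun _ => True.

Definition Q0 : ostr := @Ostr unit (fun a b => a = b) (fun a => a) (@discrete unit).

(* false = x, true = zeta(x) *)
Definition Q1 : ostr := @Ostr bool (fun a b => a = b) negb (@discrete bool).
Definition Q2 : ostr :=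
  @Ostr bool (fun a b => a = b \/ (a = false /\ b = true)) negb (@discrete bool).

Inductive four := px | py | pzx | pzy.
Definition inv4 (a : four) : four :=
  match a with px => pzx | pzx => px | py => pzy | pzy => py end.

Definition Q3 : ostr := @Ostr four
  (fun a b => a = b \/ (a = px /\ b = pzy) \/ (a = py /\ b = pzx))
  inv4 (@discrete four).
Definition Q4 : ostr := @Ostr four
  (fun a b => a = b \/ (a = px /\ b = pzy) \/ (a = py /\ b = pzy)
              \/ (a = py /\ b = pzx))
  inv4 (@discrete four).
Definition Q5 : ostr := @Ostr four
  (fun a b => a = b \/ ((a = px \/ a = py) /\ (b = pzx \/ b = pzy)))
  inv4 (@discrete four).

Definition is_topology (S : Type) (op : (S -> Prop) -> Prop) : Prop :=
  op (fun _ => True) /\ op (fun _ => False) /\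
  (forall F : (S -> Prop) -> Prop, (forall U, F U -> op U) ->
      op (fun x => exists U, F U /\ U x)) /\
  (forall U V, op U -> op V -> op (fun x => U x /\ V x)).

Definition compact (S : Type) (op : (S -> Prop) -> Prop) : Prop :=
  forall F : (S -> Prop) -> Prop, (forall U, F U -> op U) ->
    (forall x, exists U, F U /\ U x) ->
    exists l : list (S -> Prop), Forall F l /\ forall x, exists U, In U l /\ U x.

Definition hausdorff (S : Type) (op : (S -> Prop) -> Prop) : Prop :=
  forall x y, x <> y -> exists U V, op U /\ op V /\ U x /\ V y /\
    forall z, U z -> V z -> False.

Definition connected_set (S : Type) (op : (S -> Prop) -> Prop) (A : S -> Prop) : Prop :=
  ~ exists U V, op U /\ op V /\
      (forall x, A x -> U x \/ V x) /\
      (exists x, A x /\ U x) /\ (exists x, A x /\ V x) /\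
      (forall x, A x -> U x -> V x -> False).

Definition totally_disconnected (S : Type) (op : (S -> Prop) -> Prop) : Prop :=
  forall A, connected_set op A -> forall x y, A x -> A y -> x = y.

Definition stone_space (S : Type) (op : (S -> Prop) -> Prop) : Prop :=
  is_topology op /\ compact op /\ hausdorff op /\ totally_disconnected op.

Definition isolated (S : Type) (op : (S -> Prop) -> Prop) (s : S) : Prop :=
  op (fun t => t = s).

(* inl s = s, inr s = zeta(s) *)
Definition Q6 (S : Type) (op : (S -> Prop) -> Prop) (I : S -> Prop) : ostr :=
  @Ostr (S + S)
    (fun a b => a = b \/ exists x y, a = inl x /\ b = inr y /\ (x <> y \/ ~ I x))
    (fun a => match a with inl s => inr s | inr s => inl s end)
    (fun U => op (fun s => U (inl s)) /\ op (fun s => U (inr s))).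

(* Main.v *)
(** On prime ideals the operations [pc] and [dm] are read off the order and [zeta]:
    the first identity of M1 says that the spectrum has no chain of three primes, and,
    given this, the second says that two distinct primes I, J strictly below a common
    prime satisfy I <= zeta J.  Hence, writing S for the non-maximal primes of Q and
    zeta Q, the relation x < zeta y holds for all distinct x, y in S, so Q is determined
    by the set of those x in S with x < zeta x failing; |S| = 1 gives Q2, |S| = 2 gives
    Q3, Q4, Q5, and Q0, Q1 are the components without strict comparabilities.  When
    |S| >= 3 the set S is closed, being the set of primes below at least two of zeta x,
    zeta y, zeta z for distinct x, y, z in S. *)

Require Import Defs.
From Stdlib Require Import Relations List.
From Stdlib Require Import Classical ClassicalEpsilon FunctionalExtensionality PropExtensionality.
From mathcomp Require classical_sets.

Set Implicit Arguments.
Set Bullet Behavior "Strict Subproofs".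

(** * Prime ideals *)

(** Call primes [I] and [K] linked when [leP (zeta I) K]; this relation is symmetric, and every [I]
    is linked to [zeta I]. A prime contains [pc (dm x)] exactly when it is linked to a prime
    containing [x], so [pc (dm x)] acts as the diamond of a modal logic on the spectrum. The second
    identity then speaks of walks: from any prime, some prime containing [x] is reached by one or
    two links iff some such prime is reached by two or three. The fork condition shortens walks of
    three links. Conversely, a fork violating it gives such a walk, and [x] is chosen to block all
    shorter ones; this choice needs maximal primes, which is where the bound on chains enters. The
    components must be matched topologically as well. For the finite ones closed points suffice. For
    the others the compactness of the spectrum is needed; it comes from the same prime ideal
    theorem, applied to a powerset algebra. *)

Lemma prop_fun_ext (X : Type) (A B : X -> Prop) : (forall x, A x <-> B x) -> A = B.
Proof.
intros H. apply functional_extensionality; intros x.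
apply propositional_extensionality, H.
Qed.

Lemma leA_refl {L : pmAlg} (a : L) : leA a a.
Proof. unfold leA. rewrite <- (join_bot _ a) at 2. apply meet_absorb. Qed.

Lemma leA_trans {L : pmAlg} (a b c : L) : leA a b -> leA b c -> leA a c.
Proof. unfold leA; intros H1 H2. rewrite <- H1, <- meetA, H2. reflexivity. Qed.

Lemma leA_antisym {L : pmAlg} (a b : L) : leA a b -> leA b a -> a = b.
Proof. unfold leA; intros H1 H2. rewrite <- H1, meetC. exact H2. Qed.

Lemma leA_meet_l {L : pmAlg} (a b : L) : leA (meet a b) a.
Proof.
unfold leA. rewrite (meetC _ a b), <- meetA. f_equal. apply leA_refl.
Qed.

Lemma leA_meet_r {L : pmAlg} (a b : L) : leA (meet a b) b.
Proof. rewrite meetC. apply leA_meet_l. Qed.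

Lemma meet_glb {L : pmAlg} (a b c : L) : leA c a -> leA c b -> leA c (meet a b).
Proof. unfold leA; intros H1 H2. rewrite meetA, H1. exact H2. Qed.

Lemma leA_join_l {L : pmAlg} (a b : L) : leA a (join a b).
Proof. apply meet_absorb. Qed.

Lemma leA_join_r {L : pmAlg} (a b : L) : leA b (join a b).
Proof. rewrite joinC. apply leA_join_l. Qed.

Lemma join_lub {L : pmAlg} (a b c : L) : leA a c -> leA b c -> leA (join a b) c.
Proof.
unfold leA; intros H1 H2.
rewrite meetC, distr, (meetC _ c a), (meetC _ c b), H1, H2. reflexivity.
Qed.

Lemma leA_bot {L : pmAlg} (a : L) : leA (bot L) a.
Proof.
rewrite <- (join_bot _ a), joinC. apply leA_join_l.
Qed.

Lemma leA_top {L : pmAlg} (a : L) : leA a (top L).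
Proof. apply meet_top. Qed.

(** The half of the dual distributive law that makes an ideal maximal among those avoiding a filter
    prime. *)
Lemma meet_join_join {L : pmAlg} (i a b : L) :
  leA (meet (join i a) (join i b)) (join i (meet a b)).
Proof.
rewrite distr. apply join_lub.
- apply leA_trans with i; [apply leA_meet_r | apply leA_join_l].
- rewrite meetC, distr. apply join_lub.
  + apply leA_trans with i; [apply leA_meet_r | apply leA_join_l].
  + rewrite meetC. apply leA_join_r.
Qed.

Lemma dm_anti {L : pmAlg} (a b : L) : leA a b -> leA (dm b) (dm a).
Proof.
intros H. assert (E : join a b = b).
{ apply leA_antisym; [apply join_lub; [exact H | apply leA_refl] | apply leA_join_r]. }
rewrite <- E, dm_join. apply leA_meet_l.
Qed.

Lemma dm_meet {L : pmAlg} (a b : L) : dm (meet a b) = join (dm a) (dm b).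
Proof.
rewrite <- (dm_invol _ (join (dm a) (dm b))), dm_join, !dm_invol. reflexivity.
Qed.

Lemma dm_bot {L : pmAlg} : dm (bot L) = top L.
Proof.
apply leA_antisym; [apply leA_top |].
rewrite <- (dm_invol _ (top L)). apply dm_anti, leA_bot.
Qed.

Lemma dm_top {L : pmAlg} : dm (top L) = bot L.
Proof. rewrite <- dm_bot. apply dm_invol. Qed.

(** * Prime ideals from Zorn's lemma *)

Definition ideal {L : pmAlg} (A : L -> Prop) : Prop :=
  A (bot L) /\ (forall a b, leA a b -> A b -> A a) /\
  (forall a b, A a -> A b -> A (join a b)).

Definition filter {L : pmAlg} (F : L -> Prop) : Prop :=
  F (top L) /\ (forall a b, leA a b -> F a -> F b) /\
  (forall a b, F a -> F b -> F (meet a b)).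

Lemma ideal_adjoin {L : pmAlg} (J : L -> Prop) (a : L) :
  ideal J -> ideal (fun x => exists i, J i /\ leA x (join i a)).
Proof.
intros (J0 & Jd & Jj). split; [|split].
- exists (bot L). split; [exact J0 | apply leA_bot].
- intros x y Hxy (i & Hi & Hy). exists i. split; [exact Hi|].
  eapply leA_trans; eassumption.
- intros x y (i & Hi & Hx) (j & Hj & Hy). exists (join i j). split; [auto|].
  apply join_lub.
  + apply leA_trans with (join i a); [exact Hx|].
    apply join_lub; [|apply leA_join_r].
    apply leA_trans with (join i j); apply leA_join_l.
  + apply leA_trans with (join j a); [exact Hy|].
    apply join_lub; [|apply leA_join_r].
    apply leA_trans with (join i j); [apply leA_join_r | apply leA_join_l].
Qed.

Lemma prime_ideal_theorem {L : pmAlg} (A F : L -> Prop) :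
  ideal A -> filter F -> (forall a, A a -> ~ F a) ->
  exists I, prime_ideal I /\ (forall a, A a -> I a) /\ (forall a, I a -> ~ F a).
Proof.
intros HA HF Hdisj.
(* Zorn's lemma is used in the form where the union of every chain, the empty one included, must
   satisfy [P]. Stating [P] for the union of [A] and [X] makes the empty chain yield [A] itself. *)
pose (P := fun X : L -> Prop =>
  ideal (fun a => A a \/ X a) /\ forall a, A a \/ X a -> ~ F a).
destruct (@classical_sets.Zorn_bigcup L P) as (X & [HX HXF] & Xmax).
{ intros G GP Gtot.
  (* Closure under joins involves two elements, which must be found in one member of the chain; [A]
     stands in when neither comes from the chain. *)
  assert (two : forall (a b : L),
    (A a \/ classical_sets.bigcup G (fun X => X) a) ->
    (A b \/ classical_sets.bigcup G (fun X => X) b) ->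
    exists Y, (Y = A \/ G Y) /\ (A a \/ Y a) /\ (A b \/ Y b)).
  { intros a b [Ha|[X GX Xa]] [Hb|[Y GY Yb]].
    - exists A; auto.
    - exists Y; auto.
    - exists X; auto.
    - destruct (Gtot X Y GX GY) as [S|S].
      + exists Y; split; [auto|split; right; auto].
      + exists X; split; [auto|split; right; auto]. }
  assert (HY : forall Y : L -> Prop, Y = A \/ G Y -> P Y).
  { intros Y [->|GY]; [|apply GP; exact GY].
    assert (E : (fun a => A a \/ A a) = A).
    { apply prop_fun_ext; intros a; tauto. }
    split; [rewrite E; exact HA | intros a [Ha|Ha]; auto]. }
  assert (up : forall (Y : L -> Prop) a, Y = A \/ G Y -> A a \/ Y a ->
     A a \/ classical_sets.bigcup G (fun X => X) a).
  { intros Y a [->|GY] [Ha|Ya]; auto. right. exists Y; auto. }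
  split; [split; [|split]|].
  - left. apply HA.
  - intros a b Hab Hb. destruct (two b b Hb Hb) as (Y & E & Yb & _).
    destruct (HY Y E) as [(_ & Yd & _) _]. apply (up Y a E). exact (Yd a b Hab Yb).
  - intros a b Ha Hb. destruct (two a b Ha Hb) as (Y & E & Ya & Yb).
    destruct (HY Y E) as [(_ & _ & Yj) _]. apply (up Y _ E). exact (Yj a b Ya Yb).
  - intros a Ha. destruct (two a a Ha Ha) as (Y & E & Ya & _).
    destruct (HY Y E) as [_ YF]. exact (YF a Ya). }
set (I := fun a => A a \/ X a) in *.
(* By maximality the ideal generated by [I] and an outside element meets [F]. Primeness then follows
   by distributivity from two such witnesses. *)
assert (Imax : forall a, ~ I a -> exists i, I i /\ F (join i a)).
{ intros a Ha. apply NNPP; intros Hno.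
  pose (K := fun x => exists i, I i /\ leA x (join i a)).
  assert (IK : forall x, I x -> K x).
  { intros x Ix. exists x. split; [exact Ix|apply leA_join_l]. }
  assert (E : (fun x => A x \/ K x) = K).
  { apply prop_fun_ext; intros x.
    split; [intros [H|H]; [apply IK; left; exact H|exact H]|auto]. }
  apply (Xmax K).
  - split; [intros x Hx; apply IK; right; exact Hx|].
    intros S. apply Ha. right. apply S. exists (bot L).
    split; [apply HX|apply leA_join_r].
  - split.
    + change (ideal (fun x => A x \/ K x)). rewrite E. apply ideal_adjoin, HX.
    + intros x Hx Fx. assert (Kx : K x) by (rewrite <- E; exact Hx).
      destruct Kx as (i & Ii & Hi).
      apply Hno. exists i. split; [exact Ii|].
      destruct HF as (_ & Fu & _). exact (Fu _ _ Hi Fx). }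
exists I. destruct HX as (I0 & Id & Ij). destruct HF as (F1 & Fu & Fm).
split; [|split; [intros a Ha; left; exact Ha|exact HXF]].
repeat split; auto.
- intros I1. exact (HXF _ I1 F1).
- intros a b Iab. apply NNPP; intros Hno. apply not_or_and in Hno as [Ha Hb].
  destruct (Imax a Ha) as (i & Ii & Fi), (Imax b Hb) as (j & Ij' & Fj).
  apply (HXF (join (join i j) (meet a b))); [apply Ij; auto|].
  apply Fu with (meet (join (join i j) a) (join (join i j) b)); [apply meet_join_join|].
  apply Fm; [apply Fu with (join i a) | apply Fu with (join j b)]; auto.
  + apply join_lub; [|apply leA_join_r].
    apply leA_trans with (join i j); apply leA_join_l.
  + apply join_lub; [|apply leA_join_r].
    apply leA_trans with (join i j); [apply leA_join_r | apply leA_join_l].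
Qed.

Lemma prime_is_ideal {L : pmAlg} (I : L -> Prop) : prime_ideal I -> ideal I.
Proof. intros (H1 & H2 & H3 & _). split; auto. Qed.

Lemma prime_compl_filter {L : pmAlg} (I : L -> Prop) :
  prime_ideal I -> filter (fun a => ~ I a).
Proof.
intros (H1 & H2 & H3 & H4 & H5). split; [exact H4|split].
- intros a b Hab Ha Hb. apply Ha. eauto.
- intros a b Ha Hb Hab. destruct (H5 a b Hab); auto.
Qed.

Lemma principal_ideal {L : pmAlg} (b : L) : ideal (fun a => leA a b).
Proof.
split; [apply leA_bot|split].
- intros x y H1 H2. eapply leA_trans; eassumption.
- intros x y. apply join_lub.
Qed.

Lemma principal_filter {L : pmAlg} (b : L) : filter (fun a => leA b a).
Proof.
split; [apply leA_top|split].
- intros x y H1 H2. eapply leA_trans; eassumption.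
- intros x y. apply meet_glb.
Qed.

Lemma prime_exists (L : pmAlg) : nontrivial L -> exists I : L -> Prop, prime_ideal I.
Proof.
intros hL.
destruct (prime_ideal_theorem (principal_ideal (bot L)) (principal_filter (top L)))
  as (I & HI & _).
- intros a H1 H2. apply hL. apply leA_antisym; [apply leA_bot|].
  eapply leA_trans; eassumption.
- exists I. exact HI.
Qed.

Lemma leA_prime {L : pmAlg} (a b : L) :
  leA a b <-> forall I, prime_ideal I -> I b -> I a.
Proof.
split.
- intros H I (_ & Hd & _) Ib. eauto.
- intros H. apply NNPP; intros Hab.
  destruct (prime_ideal_theorem (principal_ideal b) (principal_filter a))
    as (I & HI & Ib & Ia).
  + intros x H1 H2. apply Hab. eapply leA_trans; eassumption.
  + apply (Ia a); [apply H; [exact HI|]|apply leA_refl]. apply Ib, leA_refl.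
Qed.

Lemma prime_join {L : pmAlg} (I : L -> Prop) a b :
  prime_ideal I -> (I (join a b) <-> I a /\ I b).
Proof.
intros (H1 & H2 & H3 & _). split; [|intros []; auto].
intros H; split; eapply H2; try exact H; [apply leA_join_l|apply leA_join_r].
Qed.

Lemma prime_meet {L : pmAlg} (I : L -> Prop) a b :
  prime_ideal I -> (I (meet a b) <-> I a \/ I b).
Proof.
intros (H1 & H2 & H3 & _ & H4). split; [auto|].
intros [H|H]; eapply H2; try exact H; [apply leA_meet_l|apply leA_meet_r].
Qed.

(** For the forward direction, the filter generated by [a] and the complement of [I] is proper:
    [meet c a = bot L] gives [leA c (pc a)], hence [I c]. A prime avoiding this filter lies below
    [I] and omits [a]. *)
Lemma pc_prime {L : pmAlg} (I : L -> Prop) a : prime_ideal I ->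
  (I (pc a) <-> exists J, prime_ideal J /\ leP J I /\ ~ J a).
Proof.
intros HI. split.
- intros Ipa.
  pose (F := fun x => exists c, ~ I c /\ leA (meet c a) x).
  destruct (@prime_ideal_theorem L (fun x => leA x (bot L)) F) as (J & HJ & _ & JF).
  + apply principal_ideal.
  + destruct (prime_compl_filter HI) as (F1 & Fu & Fm). split; [|split].
    * exists (top L). split; [exact F1|apply leA_top].
    * intros x y Hxy (c & Hc & Hx). exists c; split; [exact Hc|].
      eapply leA_trans; eassumption.
    * intros x y (c & Hc & Hx) (d & Hd & Hy). exists (meet c d). split; [auto|].
      apply meet_glb.
      -- apply leA_trans with (meet c a); [|exact Hx].
         apply meet_glb; [|apply leA_meet_r].
         apply leA_trans with (meet c d); apply leA_meet_l.
      -- apply leA_trans with (meet d a); [|exact Hy].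
         apply meet_glb; [|apply leA_meet_r].
         apply leA_trans with (meet c d); [apply leA_meet_l|apply leA_meet_r].
  + intros x Hx (c & Hc & Hcx). apply Hc.
    assert (E : meet c a = bot L).
    { apply leA_antisym; [eapply leA_trans; eassumption|apply leA_bot]. }
    apply pc_spec in E. destruct HI as (_ & Hd & _). exact (Hd _ _ E Ipa).
  + exists J. split; [exact HJ|split].
    * intros c Jc. apply NNPP; intros Ic. apply (JF c Jc).
      exists c. split; [exact Ic|apply leA_meet_l].
    * intros Ja. apply (JF a Ja). exists (top L).
      split; [apply HI|apply leA_meet_r].
- intros (J & HJ & HJI & Ja). apply HJI.
  assert (E : meet (pc a) a = bot L) by (apply pc_spec, leA_refl).
  assert (H : J (meet (pc a) a)) by (rewrite E; apply HJ).
  apply prime_meet in H; [tauto|exact HJ].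
Qed.

Lemma leP_refl {L : pmAlg} (I : L -> Prop) : leP I I.
Proof. intros a Ha; exact Ha. Qed.

Lemma leP_trans {L : pmAlg} (I J K : L -> Prop) : leP I J -> leP J K -> leP I K.
Proof. intros H1 H2 a Ha; auto. Qed.

Lemma leP_antisym {L : pmAlg} (I J : L -> Prop) : leP I J -> leP J I -> I = J.
Proof.
intros H1 H2. apply prop_fun_ext; intros a. split; auto.
Qed.

Lemma zeta_zeta {L : pmAlg} (I : L -> Prop) : zeta (zeta I) = I.
Proof.
apply prop_fun_ext; intros a. unfold zeta. rewrite dm_invol. split; [apply NNPP|tauto].
Qed.

Lemma zeta_inj {L : pmAlg} (I J : L -> Prop) : zeta I = zeta J -> I = J.
Proof. intros E. rewrite <- (zeta_zeta I), E. apply zeta_zeta. Qed.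

Lemma zeta_anti {L : pmAlg} (I J : L -> Prop) : leP I J -> leP (zeta J) (zeta I).
Proof. intros H a Ha Ia. apply Ha, H, Ia. Qed.

Lemma zeta_prime {L : pmAlg} (I : L -> Prop) : prime_ideal I -> prime_ideal (zeta I).
Proof.
intros HI. pose proof HI as (H1 & H2 & H3 & H4 & H5). unfold zeta.
split; [rewrite dm_bot; exact H4|split; [|split; [|split]]].
- intros a b Hab Hb Ha. apply Hb. apply H2 with (dm a); [apply dm_anti, Hab|exact Ha].
- intros a b Ha Hb. rewrite dm_join, prime_meet; tauto.
- rewrite dm_top. auto.
- intros a b. rewrite dm_meet, prime_join; [|exact HI]. tauto.
Qed.

Lemma zeta_leP_swap {L : pmAlg} (I J : L -> Prop) : leP I (zeta J) -> leP J (zeta I).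
Proof. intros H. apply zeta_anti in H. rewrite zeta_zeta in H. exact H. Qed.

Lemma zeta_leP_swap' {L : pmAlg} (I J : L -> Prop) : leP (zeta I) J -> leP (zeta J) I.
Proof. intros H. apply zeta_anti in H. rewrite zeta_zeta in H. exact H. Qed.

Lemma pc_dm_prime {L : pmAlg} (I : L -> Prop) x : prime_ideal I ->
  (I (pc (dm x)) <-> exists K, prime_ideal K /\ leP (zeta I) K /\ K x).
Proof.
intros HI. rewrite pc_prime; [|exact HI]. split.
- intros (J & HJ & HJI & Jx). exists (zeta J).
  split; [apply zeta_prime, HJ|split; [apply zeta_anti, HJI|exact Jx]].
- intros (K & HK & HIK & Kx). exists (zeta K).
  split; [apply zeta_prime, HK|split; [apply zeta_leP_swap', HIK|]].
  unfold zeta. rewrite dm_invol. tauto.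
Qed.

Lemma dm_pc_dm_prime {L : pmAlg} (I : L -> Prop) x : prime_ideal I ->
  (I (dm (pc (dm x))) <-> ~ exists K, prime_ideal K /\ leP I K /\ K x).
Proof.
intros HI. pose proof (pc_dm_prime x (zeta_prime HI)) as H.
rewrite zeta_zeta in H. rewrite <- H. unfold zeta.
split; [tauto|apply NNPP].
Qed.

Lemma prime_above_proper {L : pmAlg} (A : L -> Prop) : ideal A -> ~ A (top L) ->
  exists I, prime_ideal I /\ leP A I.
Proof.
intros HA H1.
destruct (prime_ideal_theorem HA (principal_filter (top L))) as (I & HI & AI & _).
- intros a Ha Hle. apply H1. destruct HA as (_ & Ad & _). eauto.
- exists I; split; auto.
Qed.

(** * The identities of M1 as order conditions *)

Definition height_le1 (L : pmAlg) : Prop :=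
  forall I J K : L -> Prop, prime_ideal I -> prime_ideal J -> prime_ideal K ->
    leP I J -> leP J K -> I = J \/ J = K.

Definition fork_closed (L : pmAlg) : Prop :=
  forall I J K : L -> Prop, prime_ideal I -> prime_ideal J -> prime_ideal K ->
    leP I K -> leP J K -> I <> K -> J <> K -> I <> J -> leP I (zeta J).

Lemma not_leP {L : pmAlg} (I J : L -> Prop) : ~ leP I J -> exists a, I a /\ ~ J a.
Proof.
intros H. apply not_all_ex_not in H as (a & Ha). exists a. tauto.
Qed.

(** At a prime [J] the inequality fails exactly when [y] separates [J] from some prime below it and
    [x] separates some prime above it from [J], that is, when [J] is the middle of a chain of
    three. *)
Lemma regular_iff_height_le1 (L : pmAlg) :
  (forall x y : L, leA (meet x (dm (pc (dm x)))) (join y (pc y))) <-> height_le1 L.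
Proof.
split.
- intros H I J K HI HJ HK HIJ HJK. apply NNPP; intros Hne.
  apply not_or_and in Hne as [NIJ NJK].
  destruct (@not_leP L K J) as (x & Kx & Jx).
  { intros KJ. apply NJK. apply leP_antisym; assumption. }
  destruct (@not_leP L J I) as (y & Jy & Iy).
  { intros JI. apply NIJ. apply leP_antisym; assumption. }
  pose proof (proj1 (leA_prime _ _) (H x y) J HJ) as HH.
  rewrite prime_join, prime_meet, pc_prime, dm_pc_dm_prime in HH by exact HJ.
  destruct HH as [Jx'|Hx].
  + split; [exact Jy|]. exists I; auto.
  + contradiction.
  + apply Hx. exists K; auto.
- intros H x y. apply leA_prime. intros J HJ.
  rewrite prime_join, prime_meet, pc_prime, dm_pc_dm_prime by exact HJ.
  intros [Jy (I & HI & HIJ & Iy)]. apply NNPP; intros Hno.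
  apply not_or_and in Hno as [Jx HK]. apply NNPP in HK as (K & HK & HJK & Kx).
  destruct (H I J K HI HJ HK HIJ HJK); subst; contradiction.
Qed.

(** Unfolding both occurrences of [pc (dm _)]: a walk of one link (to [K]) or of two links (to [N])
    leads from [I] to a prime containing [x]. *)
Lemma pc_dm_core_prime {L : pmAlg} (I : L -> Prop) x : prime_ideal I ->
  (I (pc (dm (meet x (pc (dm x))))) <->
   exists K, prime_ideal K /\ leP (zeta I) K /\
     (K x \/ exists N, prime_ideal N /\ leP (zeta K) N /\ N x)).
Proof.
intros HI. rewrite pc_dm_prime by exact HI.
split; intros (K & HK & HIK & Kx); exists K; (split; [exact HK|split; [exact HIK|]]);
  rewrite prime_meet, pc_dm_prime in * by exact HK; exact Kx.
Qed.

(** If the ideal generated by [N] and [c] were proper, a prime above it would be strictly above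
    [N]. *)
Lemma maximal_prime_join {L : pmAlg} (N : L -> Prop) c : prime_ideal N ->
  (forall K, prime_ideal K -> leP N K -> N = K) -> ~ N c ->
  exists x, N x /\ join x c = top L.
Proof.
intros HN Nmax Nc. apply NNPP; intros Hno.
destruct (@prime_above_proper L (fun x => exists i, N i /\ leA x (join i c)))
  as (K & HK & NK).
- apply ideal_adjoin, prime_is_ideal, HN.
- intros (i & Ni & Hi). apply Hno. exists i. split; [exact Ni|].
  apply leA_antisym; [apply leA_top|exact Hi].
- assert (E : N = K).
  { apply Nmax; [exact HK|]. intros i Ni. apply NK.
    exists i. split; [exact Ni|apply leA_join_l]. }
  apply Nc. rewrite E. apply NK. exists (bot L).
  split; [apply HN|apply leA_join_r].
Qed.

Lemma fork_closed_of_identity (L : pmAlg) : height_le1 L ->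
  (forall x : L, let w := meet x (pc (dm x)) in
     pc (dm w) = pc (dm (pc (dm w)))) -> fork_closed L.
Proof.
intros Hh H A B C HA HB HC HAC HBC NAC NBC NAB. apply NNPP; intros HAB.
(* For [I] strictly below [C], [zeta I] already has [zeta C] strictly below it, so nothing can lie
   strictly above it. *)
assert (max : forall I, prime_ideal I -> leP I C -> I <> C ->
  forall K, prime_ideal K -> leP (zeta I) K -> zeta I = K).
{ intros I HI HIC NIC K HK HIK.
  destruct (Hh (zeta C) (zeta I) K) as [E|E]; auto using zeta_prime, zeta_anti.
  exfalso. apply NIC. symmetry. apply zeta_inj, E. }
(* The element [x] must lie in [zeta A], in no prime above [B], and not in [zeta B]. The part [x0]
   settles the second demand, since [c] is in [B] and [join x0 c] is the top; [x1] settles the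
   third. *)
destruct (@not_leP L B (zeta A)) as (c & Bc & Ac).
{ intros HBA. apply HAB, zeta_leP_swap, HBA. }
destruct (@maximal_prime_join L (zeta A) c) as (x0 & Ax0 & E0);
  auto using zeta_prime.
destruct (@not_leP L (zeta A) (zeta B)) as (x1 & Ax1 & Bx1).
{ intros HAB'. apply NAB, zeta_inj, max; auto using zeta_prime. }
pose (x := join x0 x1).
(* The walk of three links is [B], [zeta B], [C], [zeta A]; the identity replaces it by one of
   length one or two. *)
assert (Bt : B (pc (dm (meet x (pc (dm x)))))).
{ rewrite (H x), pc_dm_prime by exact HB.
  exists (zeta B). split; [apply zeta_prime, HB|split; [apply leP_refl|]].
  apply pc_dm_core_prime; [apply zeta_prime, HB|].
  exists C. rewrite zeta_zeta. split; [exact HC|split; [exact HBC|right]].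
  exists (zeta A). split; [apply zeta_prime, HA|split; [apply zeta_anti, HAC|]].
  apply prime_join; [apply zeta_prime, HA|auto]. }
apply pc_dm_core_prime in Bt; [|exact HB].
destruct Bt as (K & HK & HBK & Kx).
apply max in HBK; auto. subst K. rewrite zeta_zeta in Kx.
destruct Kx as [Kx|(N & HN & HBN & Nx)].
- apply prime_join in Kx; tauto.
- apply prime_join in Nx; [|exact HN]. destruct Nx as [Nx0 _].
  assert (Nt : N (join x0 c)) by (apply prime_join; auto).
  rewrite E0 in Nt. apply HN in Nt. exact Nt.
Qed.

Lemma fork_closed_dual {L : pmAlg} (A B C : L -> Prop) : fork_closed L ->
  prime_ideal A -> prime_ideal B -> prime_ideal C ->
  leP C A -> leP C B -> A <> C -> B <> C -> A <> B -> leP (zeta A) B.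
Proof.
intros Hf HA HB HC HCA HCB NA NB NAB.
rewrite <- (zeta_zeta B).
apply (Hf (zeta A) (zeta B) (zeta C)); auto using zeta_prime, zeta_anti;
  intros E; apply zeta_inj in E; auto.
Qed.

Lemma identity_of_fork_closed (L : pmAlg) : fork_closed L ->
  forall x : L, let w := meet x (pc (dm x)) in
     pc (dm w) = pc (dm (pc (dm w))).
Proof.
intros Hf x w.
assert (iff_ : forall I, prime_ideal I -> (I (pc (dm w)) <-> I (pc (dm (pc (dm w)))))).
{ intros I HI. rewrite (pc_dm_prime (pc (dm w))) by exact HI.
  unfold w. rewrite pc_dm_core_prime by exact HI. split.
  - intros (K & HK & HIK & Kx).
    destruct Kx as [Kx|(N & HN & HKN & Nx)].
    (* One link is lengthened to three by going to [zeta I] and back to [I] first. *)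
    + exists (zeta I). split; [apply zeta_prime, HI|split; [apply leP_refl|]].
      apply pc_dm_core_prime; [apply zeta_prime, HI|]. rewrite zeta_zeta.
      exists I. split; [exact HI|split; [apply leP_refl|right]]. exists K; auto.
    + exists K. split; [exact HK|split; [exact HIK|]].
      apply pc_dm_core_prime; [exact HK|]. exists N; auto.
  - intros (K & HK & HIK & Kt).
    apply pc_dm_core_prime in Kt; [|exact HK].
    destruct Kt as (M & HM & HKM & [Mx|(N & HN & HMN & Nx)]).
    { exists K. split; [exact HK|split; [exact HIK|right]]. exists M; auto. }
    (* With [J = zeta M] the walk of three links is the zigzag [zeta I <= K >= J <= N]. If one of
       its inequalities collapses it is shortened directly or by the dual fork condition at [J];
       otherwise the fork [zeta I, J <= K] gives [zeta I <= M], and the walk [I, M, N] has two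
       links. *)
    assert (HJK : leP (zeta M) K) by apply zeta_leP_swap', HKM.
    set (J := zeta M) in *.
    assert (HJ : prime_ideal J) by apply zeta_prime, HM.
    assert (below : leP (zeta I) N -> exists K0, prime_ideal K0 /\ leP (zeta I) K0 /\
      (K0 x \/ exists N0, prime_ideal N0 /\ leP (zeta K0) N0 /\ N0 x)).
    { intros HIN. exists N. auto. }
    destruct (classic (J = K)) as [EJK|NJK].
    { apply below. subst K. apply leP_trans with J; assumption. }
    destruct (classic (zeta I = K)) as [EIK|NIK].
    + exists (zeta I). split; [apply zeta_prime, HI|split; [apply leP_refl|]].
      destruct (classic (N = J)) as [ENJ|NNJ].
      { left. rewrite EIK. apply HJK. rewrite <- ENJ. exact Nx. }
      destruct (classic (zeta I = N)) as [EIN|NIN]; [left; rewrite EIN; exact Nx|].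
      right. exists N. split; [exact HN|split; [|exact Nx]].
      rewrite EIK in *.
      apply (@fork_closed_dual L K N J); auto.
    + destruct (classic (J = zeta I)) as [EJI|NJI].
      { apply below. rewrite <- EJI. exact HMN. }
      exists M. split; [exact HM|split; [|right; exists N; auto]].
      rewrite <- (zeta_zeta M). fold J.
      apply (Hf (zeta I) J K); auto using zeta_prime. }
apply leA_antisym; apply leA_prime; intros I HI Hw;
  [apply (proj2 (iff_ I HI)) | apply (proj1 (iff_ I HI))]; exact Hw.
Qed.

Lemma inM1_iff (L : pmAlg) : inM1 L <-> height_le1 L /\ fork_closed L.
Proof.
unfold inM1. rewrite regular_iff_height_le1. split; intros [H1 H2]; split; auto.
- apply fork_closed_of_identity; assumption.
- apply identity_of_fork_closed, H2.
Qed.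

(** * Topology of the prime spectrum *)

Lemma openP_ext {L : pmAlg} (V W : (L -> Prop) -> Prop) :
  (forall I, prime_ideal I -> (V I <-> W I)) -> openP V -> openP W.
Proof.
intros E HV I HI WI. destruct (HV I HI) as (l & Hl & HlI & HlV); [apply E; assumption|].
exists l. split; [exact Hl|split; [exact HlI|]].
intros J HJ HlJ. apply E; auto.
Qed.

Lemma openP_mem {L : pmAlg} (a : L) : openP (fun I : L -> Prop => I a).
Proof.
intros I HI Ia. exists (cons (fun I : L -> Prop => I a) nil).
split; [|split].
- constructor; [exists a; right; reflexivity|constructor].
- constructor; [exact Ia|constructor].
- intros J _ HJ. inversion HJ; assumption.
Qed.

Lemma openP_notmem {L : pmAlg} (a : L) : openP (fun I : L -> Prop => ~ I a).
Proof.
intros I HI Ia. exists (cons (fun I : L -> Prop => ~ I a) nil).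
split; [|split].
- constructor; [exists a; left; reflexivity|constructor].
- constructor; [exact Ia|constructor].
- intros J _ HJ. inversion HJ; assumption.
Qed.

Lemma openP_full {L : pmAlg} : openP (fun _ : L -> Prop => True).
Proof. intros I _ _. exists nil. repeat split; constructor. Qed.

Lemma openP_union {L : pmAlg} (G : ((L -> Prop) -> Prop) -> Prop) :
  (forall V, G V -> openP V) -> openP (fun I => exists V, G V /\ V I).
Proof.
intros HG I HI (V & GV & VI). destruct (HG V GV I HI VI) as (l & Hl & HlI & HlV).
exists l. split; [exact Hl|split; [exact HlI|]]. intros J HJ HlJ. exists V; auto.
Qed.

Lemma openP_or {L : pmAlg} (V W : (L -> Prop) -> Prop) :
  openP V -> openP W -> openP (fun I => V I \/ W I).
Proof.
intros HV HW. apply openP_ext with (fun I => exists U, (U = V \/ U = W) /\ U I).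
- intros I _. split.
  + intros (U & [->| ->] & UI); auto.
  + intros [H|H]; eauto.
- apply openP_union. intros U [->| ->]; assumption.
Qed.

Lemma openP_and {L : pmAlg} (V W : (L -> Prop) -> Prop) :
  openP V -> openP W -> openP (fun I => V I /\ W I).
Proof.
intros HV HW I HI [VI WI].
destruct (HV I HI VI) as (l & Hl & HlI & HlV).
destruct (HW I HI WI) as (k & Hk & HkI & HkW).
exists (l ++ k). rewrite !Forall_app. split; [auto|split; [auto|]].
intros J HJ HJlk. rewrite Forall_app in HJlk. destruct HJlk. split; auto.
Qed.

Lemma openP_zeta {L : pmAlg} (V : (L -> Prop) -> Prop) :
  openP V -> openP (fun I => V (zeta I)).
Proof.
intros HV I HI VI.
destruct (HV (zeta I) (zeta_prime HI) VI) as (l & Hl & HlI & HlV).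
exists (map (fun B J => B (zeta J)) l). split; [|split].
- rewrite Forall_map. apply Forall_impl with (2 := Hl).
  intros B (a & [->| ->]); exists (dm a); [right|left].
  + apply prop_fun_ext; intros J. unfold zeta. split; [apply NNPP|tauto].
  + reflexivity.
- rewrite Forall_map. exact HlI.
- intros J HJ HlJ. rewrite Forall_map in HlJ. apply HlV; [apply zeta_prime, HJ|exact HlJ].
Qed.

(** Each [a] outside [K] witnesses the failure on a whole subbasic set. *)
Lemma openP_not_le {L : pmAlg} (K : L -> Prop) : openP (fun I => ~ leP I K).
Proof.
apply openP_ext with (fun I => exists V, (exists a, ~ K a /\ V = fun I : L -> Prop => I a) /\ V I).
- intros I _. split.
  + intros (V & (a & Ka & ->) & Ia) H. apply Ka, H, Ia.
  + intros H. apply not_leP in H as (a & Ia & Ka). exists (fun I : L -> Prop => I a). eauto.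
- apply openP_union. intros V (a & _ & ->). apply openP_mem.
Qed.

Lemma openP_not_ge {L : pmAlg} (K : L -> Prop) : openP (fun I => ~ leP K I).
Proof.
apply openP_ext with (fun I => ~ leP (zeta I) (zeta K)).
- intros I _. split; intros H H'; apply H.
  + apply zeta_anti, H'.
  + apply zeta_anti in H'. rewrite !zeta_zeta in H'. exact H'.
- apply (@openP_zeta L (fun I => ~ leP I (zeta K))), openP_not_le.
Qed.

Lemma openP_neq {L : pmAlg} (K : L -> Prop) : openP (fun I => I <> K).
Proof.
apply openP_ext with (fun I => ~ leP I K \/ ~ leP K I).
- intros I _. split.
  + intros H ->. destruct H as [H|H]; apply H, leP_refl.
  + intros H. apply not_and_or. intros []. apply H, leP_antisym; assumption.
- apply openP_or; [apply openP_not_le|apply openP_not_ge].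
Qed.

(** The list enumerates a finite set while [P] selects from it classically, so that an arbitrary
    subset can be avoided. *)
Lemma openP_avoid_list {L : pmAlg} (T : Type) (g : T -> L -> Prop) (P : T -> Prop)
  (l : list T) : openP (fun I => forall n, In n l -> P n -> I <> g n).
Proof.
induction l as [|n l IH].
- apply openP_ext with (fun _ => True); [|apply openP_full].
  intros I _. split; [intros _ n []|auto].
- apply openP_ext with (fun I => (P n -> I <> g n) /\ forall m, In m l -> P m -> I <> g m).
  + intros I _. split.
    * intros [H1 H2] m [<-|Hm]; auto.
    * intros H. split; [apply H; left; reflexivity|intros m Hm; apply H; right; exact Hm].
  + apply openP_and; [|exact IH].
    destruct (classic (P n)) as [Pn|Pn].
    * apply openP_ext with (fun I => I <> g n); [tauto|apply openP_neq].
    * apply openP_ext with (fun _ => True); [tauto|apply openP_full].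
Qed.

(* A prime ideal of the powerset is the complement of an ultrafilter, so the
   prime ideal theorem for pm-algebras already contains the ultrafilter lemma. *)
Definition powerset (X : Type) : pmAlg.
Proof.
refine (@PmAlg (X -> Prop) (fun A B x => A x /\ B x) (fun A B x => A x \/ B x)
  (fun A x => ~ A x) (fun A x => ~ A x) (fun _ => False) (fun _ => True)
  _ _ _ _ _ _ _ _ _ _ _ _); try (intros; apply prop_fun_ext; intros x; tauto).
- intros A B. split; intros E.
  + apply prop_fun_ext; intros x. split; [tauto|]. intros Bx. split; [exact Bx|].
    intros Ax. change ((fun _ : X => False) x). rewrite <- E. auto.
  + apply prop_fun_ext; intros x. split; [|tauto]. intros [Bx Ax].
    rewrite <- E in Bx. tauto.
Defined.

Lemma powerset_leA (X : Type) (A B : powerset X) :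
  leA A B <-> forall x, A x -> B x.
Proof.
split.
- intros E x Ax. rewrite <- E in Ax. apply Ax.
- intros H. apply prop_fun_ext; intros x; simpl. split; [tauto|auto].
Qed.

(** [N] is the complement of an ultrafilter containing [T], and [fun a => ~ N (fun I => I a)] is its
    limit: [a] belongs to it when almost all primes contain [a]. *)
Lemma prime_limit {L : pmAlg} (T : (L -> Prop) -> Prop)
  (N : powerset (L -> Prop) -> Prop) :
  (forall I, T I -> prime_ideal I) -> prime_ideal N -> N (fun I => ~ T I) ->
  prime_ideal (fun a => ~ N (fun I => I a)) /\
  forall V, openP V -> V (fun a => ~ N (fun I => I a)) -> ~ N V.
Proof.
intros HT HN NT.
assert (mono : forall A B : (L -> Prop) -> Prop,
  (forall I, T I -> A I -> B I) -> N B -> N A).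
{ intros A B H NB. destruct HN as (_ & Nd & Nj & _).
  apply Nd with (@join (powerset (L -> Prop)) B (fun I => ~ T I)); [|auto].
  apply powerset_leA; simpl. intros I AI. destruct (classic (T I)); auto. }
assert (neg : forall A : (L -> Prop) -> Prop, N A -> ~ N (fun I => ~ A I)).
{ intros A NA NnA. destruct HN as (_ & Nd & Nj & N1 & _). apply N1.
  apply Nd with (@join (powerset (L -> Prop)) A (fun I => ~ A I)); [|auto].
  apply powerset_leA; simpl. intros I _. apply classic. }
assert (cap : forall A B : (L -> Prop) -> Prop, N (fun I => A I /\ B I) -> N A \/ N B).
{ intros A B. apply HN. }
assert (lim : prime_ideal (fun a => ~ N (fun I => I a))).
{ split; [|split; [|split; [|split]]].
  - intros H. apply (neg _ NT). apply mono with (2 := H). intros I TI _. apply (HT I TI).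
  - intros a b Hab Hb Ha. apply Hb. apply mono with (2 := Ha).
    intros I TI Ib. destruct (HT I TI) as (_ & Id & _). eauto.
  - intros a b Ha Hb H. destruct (cap (fun I => I a) (fun I => I b)); auto.
    apply mono with (2 := H). intros I TI []. destruct (HT I TI) as (_ & _ & Ij & _). auto.
  - intros H. apply H. apply mono with (fun _ => False).
    + intros I TI I1. apply (HT I TI), I1.
    + apply HN.
  - intros a b H. apply NNPP; intros Hno. apply not_or_and in Hno as [Ha Hb].
    apply NNPP in Ha, Hb. apply H.
    destruct HN as (_ & Nd & Nj & _).
    apply mono with (@join (powerset (L -> Prop)) (fun I => I a) (fun I => I b)); [|auto].
    intros I TI; simpl. apply (HT I TI). }
split; [exact lim|].
intros V HV Vlim NV.
destruct (HV _ lim Vlim) as (l & Hl & Hllim & HlV).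
assert (Nl : N (fun I => Forall (fun B => B I) l)).
{ apply mono with (2 := NV). intros I TI. apply HlV, HT, TI. }
clear HV Vlim NV HlV.
induction l as [|B l IH].
- apply HN. apply mono with (2 := Nl). intros; constructor.
- apply Forall_cons_iff in Hl as [HB Hl]. apply Forall_cons_iff in Hllim as [HBlim Hllim].
  destruct (cap B (fun I => Forall (fun B => B I) l)) as [NB|NB].
  + apply mono with (2 := Nl). intros I _ []; constructor; auto.
  + destruct HB as (a & [->| ->]).
    * apply NNPP in HBlim. exact (neg _ HBlim NB).
    * exact (HBlim NB).
  + exact (IH Hl Hllim NB).
Qed.

(** The sets whose trace on [T] is finitely covered form an ideal of the powerset. If it is proper
    it extends to a prime [N], whose limit can lie neither in [T], where a member of [G] covers it,
    nor in the open complement of [T]. *)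
Lemma closed_compact {L : pmAlg} (T : (L -> Prop) -> Prop)
  (G : ((L -> Prop) -> Prop) -> Prop) :
  (forall I, T I -> prime_ideal I) -> openP (fun I => ~ T I) ->
  (forall V, G V -> openP V) -> (forall I, T I -> exists V, G V /\ V I) ->
  exists l, Forall G l /\ forall I, T I -> exists V, In V l /\ V I.
Proof.
intros HT Tcl HG Tcov. apply NNPP; intros Hno.
pose (A := fun D : powerset (L -> Prop) =>
  exists l, Forall G l /\ forall I, T I -> D I -> exists V, In V l /\ V I).
destruct (@prime_ideal_theorem (powerset (L -> Prop)) A (leA (top _)))
  as (N & HN & AN & _).
- split; [|split].
  + exists nil. split; [constructor|]. intros I _ [].
  + intros D E HDE (l & Hl & Hcov). exists l. split; [exact Hl|].
    intros I TI DI. apply Hcov; [exact TI|]. revert DI. apply powerset_leA, HDE.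
  + intros D E (l & Hl & Hcov) (k & Hk & Hcov'). exists (l ++ k).
    rewrite Forall_app. split; [auto|].
    intros I TI [DI|EI]; [destruct (Hcov I TI DI) as (V & Vl & VI)
      |destruct (Hcov' I TI EI) as (V & Vl & VI)];
      exists V; rewrite in_app_iff; auto.
- apply principal_filter.
- intros D (l & Hl & Hcov) H1. apply Hno. exists l. split; [exact Hl|].
  intros I TI. apply Hcov; [exact TI|]. apply (proj1 (powerset_leA _ _) H1). exact Logic.I.
- assert (NT : N (fun I => ~ T I)).
  { apply AN. exists nil. split; [constructor|]. intros I TI HI. contradiction. }
  destruct (prime_limit T HT HN NT) as [lim Nlim].
  destruct (classic (T (fun a => ~ N (fun I => I a)))) as [Tl|Tl].
  + destruct (Tcov _ Tl) as (V & GV & Vl).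
    apply (Nlim V (HG V GV) Vl). apply AN. exists (cons V nil).
    split; [constructor; [exact GV|constructor]|].
    intros I _ VI. exists V. split; [left; reflexivity|exact VI].
  + exact (Nlim _ Tcl Tl NT).
Qed.

(** Models are easier to parametrise than to map into. [iso_to] wants a function on all predicates,
    so [g] is inverted by [epsilon], with an arbitrary value off the subspace; hence [inhabited]. *)
Lemma iso_intro {L : pmAlg} (Q : (L -> Prop) -> Prop) (M : ostr)
  (g : ocar M -> L -> Prop) : inhabited (ocar M) ->
  (forall m, Q (g m) \/ Q (zeta (g m))) ->
  (forall I, Q I \/ Q (zeta I) -> exists m, g m = I) ->
  (forall m n, g m = g n -> m = n) ->
  (forall m n, leP (g m) (g n) <-> ole M m n) ->
  (forall m, g (oinv M m) = zeta (g m)) ->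
  (forall U, oopen M U <-> exists V, openP V /\ forall m, V (g m) <-> U m) ->
  iso_to Q M.
Proof.
intros Hi gQ gsurj ginj gle ginv gopen.
pose (f := fun I => epsilon Hi (fun m => g m = I)).
assert (gf : forall I, Q I \/ Q (zeta I) -> g (f I) = I).
{ intros I HI. apply (epsilon_spec Hi (fun m => g m = I)), gsurj, HI. }
assert (fg : forall m, f (g m) = m).
{ intros m. apply ginj, gf, gQ. }
exists f. split; [|split; [|split; [|split]]].
- intros I J HI HJ E. rewrite <- (gf I HI), <- (gf J HJ), E. reflexivity.
- intros m. exists (g m). auto.
- intros I J HI HJ. rewrite <- gle, !gf by assumption. reflexivity.
- intros I HI. apply ginj. rewrite ginv, !gf; [reflexivity|exact HI|].
  rewrite zeta_zeta. tauto.
- intros U. rewrite gopen. split; intros (V & HV & E); exists V; (split; [exact HV|]).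
  + intros I HI. rewrite <- E, gf by exact HI. reflexivity.
  + intros m. rewrite (E (g m) (gQ m)), fg. reflexivity.
Qed.

Lemma finite_discrete {L : pmAlg} (X : Type) (g : X -> L -> Prop) (e : list X) (U : X -> Prop) :
  (forall m, In m e) -> (forall m n, g m = g n -> m = n) ->
  exists V, openP V /\ forall m, V (g m) <-> U m.
Proof.
intros He ginj. exists (fun I => forall n, In n e -> ~ U n -> I <> g n).
split; [apply openP_avoid_list|]. intros m. split.
- intros H. apply NNPP; intros Um. exact (H m (He m) Um eq_refl).
- intros Um n _ Un E. apply ginj in E. subst n. contradiction.
Qed.

(** * Order components *)

Definition component {L : pmAlg} (I J : L -> Prop) : Prop :=
  prime_ideal J /\
  clos_refl_trans _ (fun X Y => prime_ideal X /\ prime_ideal Y /\ comparableP X Y) I J.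

Lemma comparableP_sym {L : pmAlg} (I J : L -> Prop) : comparableP I J -> comparableP J I.
Proof. unfold comparableP; tauto. Qed.

Lemma clos_rt_sym (X : Type) (R : X -> X -> Prop) a b :
  (forall u v, R u v -> R v u) -> clos_refl_trans _ R a b -> clos_refl_trans _ R b a.
Proof.
intros H P. induction P; [apply rt_step; auto|apply rt_refl|eapply rt_trans; eassumption].
Qed.

Lemma clos_rt_mono (X : Type) (R R' : X -> X -> Prop) a b :
  (forall u v, R u v -> R' u v) -> clos_refl_trans _ R a b -> clos_refl_trans _ R' a b.
Proof.
intros H P. induction P; [apply rt_step; auto|apply rt_refl|eapply rt_trans; eassumption].
Qed.

Lemma component_order_component {L : pmAlg} (I : L -> Prop) :
  prime_ideal I -> order_component (component I).
Proof.
intros HI. split; [split|].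
- intros J [HJ _]. exact HJ.
- assert (from : forall J, component I J -> clos_refl_trans _
    (fun X Y => component I X /\ component I Y /\ comparableP X Y) I J).
  { intros J [HJ P]. apply clos_rt_rtn1 in P. induction P as [|J K (H1 & H2 & H3) P IH].
    - apply rt_refl.
    - apply rt_trans with J; [exact (IH H1)|]. apply rt_step.
      assert (CJ : component I J) by (split; [exact H1|apply clos_rtn1_rt, P]).
      split; [exact CJ|split; [|exact H3]]. split; [exact H2|].
      apply rt_trans with J; [apply CJ|apply rt_step; auto]. }
  intros J K HJ HK. apply rt_trans with I; [|apply from, HK].
  apply clos_rt_sym; [|apply from, HJ].
  intros X Y (H1 & H2 & H3). auto using comparableP_sym.
- intros D [Dp Dc] CD J DJ. split; [apply Dp, DJ|].
  apply clos_rt_mono with (2 := Dc I J (CD I (conj HI (rt_refl _ _ _))) DJ).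
  intros X Y (H1 & H2 & H3). auto.
Qed.

(** The empty set is connected, so it is excluded only by the existence of a prime, which
    nontriviality provides. *)
Lemma order_component_nonempty {L : pmAlg} (Q : (L -> Prop) -> Prop) :
  nontrivial L -> order_component Q -> exists I, Q I.
Proof.
intros hL [_ Qmax]. apply NNPP; intros Hno.
destruct (prime_exists hL) as (I & HI). apply Hno. exists I.
apply (Qmax (component I)).
- apply component_order_component, HI.
- intros J QJ. exfalso. eauto.
- split; [exact HI|apply rt_refl].
Qed.

(** Adjoining [K] keeps [Q] connected, through [J]; maximality then absorbs [K]. *)
Lemma order_component_closed {L : pmAlg} (Q : (L -> Prop) -> Prop) (J K : L -> Prop) :
  order_component Q -> Q J -> prime_ideal K -> comparableP J K -> Q K.
Proof.
intros [[Qp Qc] Qmax] QJ HK HJK.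
apply (Qmax (fun I => Q I \/ I = K)); auto. split.
- intros I [QI| ->]; auto.
- pose (R := fun X Y : L -> Prop => (Q X \/ X = K) /\ (Q Y \/ Y = K) /\ comparableP X Y).
  assert (toJ : forall I, Q I \/ I = K -> clos_refl_trans _ R J I).
  { intros I [QI| ->].
    - apply clos_rt_mono with (2 := Qc J I QJ QI). intros X Y (H1 & H2 & H3).
      unfold R; auto.
    - apply rt_step. unfold R; auto. }
  intros X Y HX HY. apply rt_trans with J; [|apply toJ, HY].
  apply clos_rt_sym; [|apply toJ, HX].
  unfold R. intros U V (H1 & H2 & H3). auto using comparableP_sym.
Qed.

Lemma order_component_ind {L : pmAlg} (Q T : (L -> Prop) -> Prop) (I : L -> Prop) :
  order_component Q -> Q I -> T I ->
  (forall J K, T J -> prime_ideal J -> prime_ideal K -> comparableP J K -> T K) ->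
  forall J, Q J -> T J.
Proof.
intros [[Qp Qc] _] QI TI Tstep J QJ.
pose proof (clos_rt_rtn1 _ _ _ _ (Qc I J QI QJ)) as P. clear QJ.
induction P as [|J K (H1 & H2 & H3) P IH]; [exact TI|].
apply Tstep with J; auto.
Qed.

Lemma zeta_component_closed {L : pmAlg} (Q : (L -> Prop) -> Prop) (J K : L -> Prop) :
  order_component Q -> Q J \/ Q (zeta J) -> prime_ideal K -> comparableP J K ->
  Q K \/ Q (zeta K).
Proof.
intros HQ HJ HK HJK. destruct HJ as [QJ|QJ]; [left|right].
- apply order_component_closed with J; assumption.
- apply order_component_closed with (zeta J); [assumption|assumption|apply zeta_prime, HK|].
  destruct HJK; [right|left]; apply zeta_anti; assumption.
Qed.

(** * From the classification to the order conditions *)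

Definition ostr_height_le1 (M : ostr) : Prop :=
  forall a b c, ole M a b -> ole M b c -> a = b \/ b = c.

Definition ostr_fork_closed (M : ostr) : Prop :=
  forall a b c, ole M a c -> ole M b c -> a <> c -> b <> c -> a <> b -> ole M a (oinv M b).

(** A chain or a fork stays within one component, and [iso_to] respects order and involution, so
    both conditions can be checked on the models. *)
Lemma order_conditions_of_iso (L : pmAlg) :
  (forall Q : (L -> Prop) -> Prop, order_component Q ->
     exists M, iso_to Q M /\ ostr_height_le1 M /\ ostr_fork_closed M) ->
  height_le1 L /\ fork_closed L.
Proof.
intros H.
assert (get : forall I : L -> Prop, prime_ideal I -> exists Q, order_component Q /\ Q I).
{ intros I HI. exists (component I).
  split; [apply component_order_component, HI|split; [exact HI|apply rt_refl]]. }
split; intros I J K HI HJ HK.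
- intros HIJ HJK.
  destruct (get J HJ) as (Q & HQ & QJ).
  assert (QI : Q I) by (apply order_component_closed with J; auto; right; exact HIJ).
  assert (QK : Q K) by (apply order_component_closed with J; auto; left; exact HJK).
  destruct (H Q HQ) as (M & (f & finj & _ & fle & _) & M1 & _).
  destruct (M1 (f I) (f J) (f K)) as [E|E];
    [apply fle; auto|apply fle; auto|left|right]; apply finj; auto.
- intros HIK HJK NIK NJK NIJ.
  destruct (get K HK) as (Q & HQ & QK).
  assert (QI : Q I) by (apply order_component_closed with K; auto; right; exact HIK).
  assert (QJ : Q J) by (apply order_component_closed with K; auto; right; exact HJK).
  destruct (H Q HQ) as (M & (f & finj & _ & fle & fz & _) & _ & M2).
  apply fle; [auto|right; rewrite zeta_zeta; exact QJ|].
  rewrite fz by auto.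
  apply (M2 (f I) (f J) (f K)); try (apply fle; auto);
    intros E; apply finj in E; auto.
Qed.

Ltac finite_order :=
  split; intros [] [] []; simpl; intuition congruence.

Lemma order_conditions_of_list {L : pmAlg} (Q : (L -> Prop) -> Prop) :
  iso_to Q Q0 \/ iso_to Q Q1 \/ iso_to Q Q2 \/ iso_to Q Q3 \/
  iso_to Q Q4 \/ iso_to Q Q5 \/
  (exists (S : Type) (op : (S -> Prop) -> Prop) (I : S -> Prop), iso_to Q (Q6 op I)) ->
  exists M, iso_to Q M /\ ostr_height_le1 M /\ ostr_fork_closed M.
Proof.
intros [H|[H|[H|[H|[H|[H|(S & op & I & H)]]]]]];
  eexists; (split; [exact H|]); clear H; try finite_order.
split; simpl.
- intros a b c [->|(x & y & -> & -> & _)] H; [left; reflexivity|].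
  destruct H as [H|(u & v & H & _)]; [right; exact H|discriminate].
- intros a b c [->|(x & y & -> & -> & Hxy)]; [congruence|].
  intros [->|(u & v & -> & E & Huv)]; [congruence|]. intros _ _ N.
  right. exists x, u. split; [reflexivity|split; [reflexivity|left; congruence]].
Qed.

(** * Classification of the components *)

Definition low {L : pmAlg} (I : L -> Prop) : Prop :=
  exists J, prime_ideal J /\ leP I J /\ I <> J.

(** The set S of the overview, described from one base point [x] without paths; that it exhausts the
    non-maximal part of the component rests on the fork condition. *)
Definition lower_part {L : pmAlg} (x y : L -> Prop) : Prop :=
  prime_ideal y /\ low y /\ (y = x \/ leP y (zeta x)).

Definition zeta_lower_part {L : pmAlg} (x y : L -> Prop) : Prop :=
  lower_part x y \/ lower_part x (zeta y).

Section LowerPart.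

Variables (L : pmAlg) (x : L -> Prop).
Hypotheses (Hh : height_le1 L) (Hf : fork_closed L) (Px : prime_ideal x) (Lx : low x).

Lemma low_minimal (I J : L -> Prop) :
  prime_ideal I -> prime_ideal J -> low I -> leP J I -> J = I.
Proof.
intros HI HJ (C & HC & HIC & NIC) HJI.
destruct (Hh HJ HI HC HJI HIC); [assumption|contradiction].
Qed.

(** [zeta J] has [zeta C] strictly below it for any [C] strictly above [J], whereas low primes are
    minimal. *)
Lemma low_not_above_zeta (I J : L -> Prop) :
  prime_ideal I -> prime_ideal J -> low I -> low J -> ~ leP (zeta J) I.
Proof.
intros HI HJ LI (C & HC & HJC & NJC) HJI.
apply low_minimal in HJI; auto using zeta_prime. subst I.
apply NJC. symmetry. apply zeta_inj, low_minimal; auto using zeta_prime, zeta_anti.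
Qed.

Lemma lower_part_self : lower_part x x.
Proof. unfold lower_part; auto. Qed.

Lemma lower_part_le y z : lower_part x y -> lower_part x z -> (leP y z <-> y = z).
Proof.
intros (Py & Ly & _) (Pz & Lz & _). split; [apply low_minimal; assumption|].
intros ->; apply leP_refl.
Qed.

Lemma lower_part_zeta_le y z :
  lower_part x y -> lower_part x z -> (leP (zeta y) (zeta z) <-> y = z).
Proof.
intros Sy Sz. split; [|intros ->; apply leP_refl].
intros H. apply zeta_anti in H. rewrite !zeta_zeta in H.
symmetry. apply lower_part_le; assumption.
Qed.

Lemma lower_part_not_zeta_le y z :
  lower_part x y -> lower_part x z -> ~ leP (zeta y) z.
Proof. intros (Py & Ly & _) (Pz & Lz & _). apply low_not_above_zeta; assumption. Qed.

(** Unless one of them is [x], both points lie strictly below [zeta x], and the fork condition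
    applies there. *)
Lemma lower_part_le_zeta y z :
  lower_part x y -> lower_part x z -> y <> z -> leP y (zeta z).
Proof.
intros Sy Sz N. pose proof Sy as (Py & Ly & Hy). pose proof Sz as (Pz & Lz & Hz).
destruct Hy as [->|Hy].
- destruct Hz as [->|Hz]; [contradiction|apply zeta_leP_swap, Hz].
- destruct Hz as [->|Hz]; [exact Hy|].
  apply (Hf Py Pz (zeta_prime Px)); auto; intros E;
    [apply (@low_not_above_zeta y x)|apply (@low_not_above_zeta z x)]; auto;
    rewrite <- E; apply leP_refl.
Qed.

(** Minimality of [y] leaves only [y] strictly below [z]. If [y] is not [x], then [zeta x] and [z]
    both lie above [y], and the dual fork condition gives [leP x z], unless they coincide. *)
Lemma lower_part_comparable y z :
  lower_part x y -> prime_ideal z -> comparableP y z -> zeta_lower_part x z.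
Proof.
intros (Py & Ly & Hy) Pz Hyz.
destruct (classic (y = z)) as [<-|N]; [left; unfold lower_part; auto|].
destruct Hyz as [Hyz|Hzy]; [|exfalso; apply N; symmetry; apply low_minimal; auto].
right. split; [apply zeta_prime, Pz|split].
- exists (zeta y). split; [apply zeta_prime, Py|split; [apply zeta_anti, Hyz|]].
  intros E. apply N. symmetry. apply zeta_inj, E.
- destruct Hy as [->|Hy]; [right; apply zeta_anti, Hyz|].
  destruct (classic (zeta x = z)) as [<-|Nz]; [left; apply zeta_zeta|right].
  apply zeta_anti. rewrite <- (zeta_zeta x).
  apply (@fork_closed_dual L (zeta x) z y); auto using zeta_prime.
  intros E. apply (@low_not_above_zeta y x); auto. rewrite E. apply leP_refl.
Qed.

Lemma zeta_lower_part_zeta y : zeta_lower_part x y -> zeta_lower_part x (zeta y).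
Proof. unfold zeta_lower_part. rewrite zeta_zeta. tauto. Qed.

Lemma zeta_lower_part_comparable y z :
  zeta_lower_part x y -> prime_ideal z -> comparableP y z -> zeta_lower_part x z.
Proof.
intros [Sy|Sy] Pz Hyz; [apply lower_part_comparable with y; assumption|].
rewrite <- (zeta_zeta z). apply zeta_lower_part_zeta.
apply lower_part_comparable with (zeta y); [assumption|apply zeta_prime, Pz|].
destruct Hyz; [right|left]; apply zeta_anti; assumption.
Qed.

(** S together with its image is closed under comparability, so it absorbs the component; conversely
    each point of S other than [x] is one step from [zeta x]. *)
Lemma component_lower_part (Q : (L -> Prop) -> Prop) :
  order_component Q -> Q x \/ Q (zeta x) ->
  forall J, Q J \/ Q (zeta J) <-> zeta_lower_part x J.
Proof.
intros HQ Qx.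
assert (Tx : zeta_lower_part x x) by (left; apply lower_part_self).
assert (QT : forall J, Q J -> zeta_lower_part x J).
{ intros J QJ. destruct Qx as [Qx|Qx].
  - apply (@order_component_ind L Q (zeta_lower_part x) x); auto.
    intros; eapply zeta_lower_part_comparable; eassumption.
  - apply (@order_component_ind L Q (zeta_lower_part x) (zeta x));
      auto using zeta_lower_part_zeta.
    intros; eapply zeta_lower_part_comparable; eassumption. }
assert (SQ : forall J, lower_part x J -> Q J \/ Q (zeta J)).
{ intros J (PJ & _ & [->|HJ]); [exact Qx|].
  apply zeta_component_closed with (zeta x); auto.
  - rewrite zeta_zeta. tauto.
  - right. exact HJ. }
intros J. split.
- intros [QJ|QJ]; [auto|]. rewrite <- (zeta_zeta J). auto using zeta_lower_part_zeta.
- intros [SJ|SJ]; [auto|]. apply SQ in SJ. rewrite zeta_zeta in SJ. tauto.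
Qed.

Lemma lower_part_open_compl :
  (exists y z, lower_part x y /\ lower_part x z /\ x <> y /\ x <> z /\ y <> z) ->
  openP (fun I => ~ lower_part x I).
Proof.
intros (y & z & Sy & Sz & Nxy & Nxz & Nyz). pose proof lower_part_self as Sx.
(* A member I of the lower part is below zeta u for every u <> I in it, hence below
   at least two of zeta x, zeta y, zeta z; this majority condition is closed and
   conversely forces membership. *)
apply openP_ext with (fun I => (~ leP I (zeta x) /\ ~ leP I (zeta y)) \/
  (~ leP I (zeta x) /\ ~ leP I (zeta z)) \/ (~ leP I (zeta y) /\ ~ leP I (zeta z))).
2: { repeat apply openP_or; apply openP_and; apply openP_not_le. }
(* Of two distinct upper bounds one is strict, so [I] is low; comparability with [zeta u] places it
   in S or its image, and a low prime cannot be in the image. *)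
assert (two : forall I u v, prime_ideal I -> lower_part x u -> lower_part x v -> u <> v ->
  leP I (zeta u) -> leP I (zeta v) -> lower_part x I).
{ intros I u v HI Su Sv N Hu Hv.
  assert (LI : low I).
  { destruct (classic (I = zeta u)) as [->|N'].
    - exists (zeta v). split; [apply zeta_prime, Sv|split; [exact Hv|]].
      intros E. apply N, zeta_inj, E.
    - exists (zeta u). split; [apply zeta_prime, Su|auto]. }
  assert (TI : zeta_lower_part x I).
  { apply zeta_lower_part_comparable with (zeta u); [|exact HI|right; exact Hu].
    apply zeta_lower_part_zeta. left; exact Su. }
  destruct TI as [SI|SI]; [exact SI|].
  exfalso. apply (@low_not_above_zeta I (zeta I)); auto using zeta_prime.
  - apply SI.
  - rewrite zeta_zeta. apply leP_refl. }
intros I HI. split.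
- intros H SI.
  assert (E : forall u, lower_part x u -> ~ leP I (zeta u) -> I = u).
  { intros u Su Nu. apply NNPP; intros N. apply Nu, lower_part_le_zeta; assumption. }
  destruct H as [[H1 H2]|[[H1 H2]|[H1 H2]]]; apply E in H1, H2; auto; congruence.
- intros H.
  destruct (classic (leP I (zeta x))) as [Ix|Ix], (classic (leP I (zeta y))) as [Iy|Iy],
    (classic (leP I (zeta z))) as [Iz|Iz]; auto; exfalso; apply H.
  + apply (two I x y); auto.
  + apply (two I x y); auto.
  + apply (two I x z); auto.
  + apply (two I y z); auto.
Qed.

End LowerPart.

(** * The finite components *)

Lemma finite_iso {L : pmAlg} (Q : (L -> Prop) -> Prop) (M : ostr) (e : list (ocar M))
  (g : ocar M -> L -> Prop) : inhabited (ocar M) -> (forall m, In m e) ->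
  (forall U, oopen M U) -> (forall m n, ole M m n -> ole M n m -> m = n) ->
  (forall m, Q (g m) \/ Q (zeta (g m))) ->
  (forall I, Q I \/ Q (zeta I) -> exists m, g m = I) ->
  (forall m n, leP (g m) (g n) <-> ole M m n) ->
  (forall m, g (oinv M m) = zeta (g m)) ->
  iso_to Q M.
Proof.
intros Hi He Hd Ha gQ gsurj gle gz.
(* Equal images are mutually comparable, so antisymmetry of the model gives injectivity. *)
assert (ginj : forall m n, g m = g n -> m = n).
{ intros m n E. apply Ha; apply gle; rewrite E; apply leP_refl. }
apply iso_intro with g; auto.
intros U. split; [|auto]. intros _. exact (finite_discrete g e U He ginj).
Qed.

(** Nothing is strictly above [I], and nothing strictly below it since nothing is strictly above
    [zeta I]. Whether [I] is fixed by [zeta] decides between the two models. *)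
Lemma component_isolated {L : pmAlg} (Q : (L -> Prop) -> Prop) (I : L -> Prop) :
  order_component Q -> Q I -> ~ low I -> ~ low (zeta I) -> iso_to Q Q0 \/ iso_to Q Q1.
Proof.
intros HQ QI N1 N2. assert (PI : prime_ideal I) by apply HQ, QI.
assert (QE : forall J, Q J -> J = I).
{ apply (@order_component_ind L Q (fun J => J = I) I); auto.
  intros J K -> _ PK [H|H]; apply NNPP; intros N.
  - apply N1. exists K; auto.
  - apply N2. exists (zeta K). split; [apply zeta_prime, PK|split; [apply zeta_anti, H|]].
    intros E. apply N. symmetry. apply zeta_inj, E. }
assert (TE : forall J, Q J \/ Q (zeta J) -> J = I \/ J = zeta I).
{ intros J [H|H]; apply QE in H; [left; exact H|right].
  rewrite <- H, zeta_zeta. reflexivity. }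
assert (Z : forall J, J = I \/ J = zeta I -> Q J \/ Q (zeta J)).
{ intros J [->| ->]; rewrite ?zeta_zeta; auto. }
destruct (classic (I = zeta I)) as [E|E]; [left|right].
- apply finite_iso with (e := cons tt nil) (g := fun _ : unit => I); simpl; auto.
  + constructor; exact tt.
  + intros []; auto.
  + intros U. exact Logic.I.
  + intros J HJ. exists tt. destruct (TE J HJ); congruence.
  + intros [] []. split; [reflexivity|intros _; apply leP_refl].
- assert (NI : ~ leP I (zeta I)).
  { intros H. apply N1. exists (zeta I). split; [apply zeta_prime, PI|auto]. }
  assert (NzI : ~ leP (zeta I) I).
  { intros H. apply N2. exists I. auto. }
  apply finite_iso with (M := Q1) (e := cons true (cons false nil))
    (g := fun b : bool => if b then zeta I else I); simpl; auto.
  + constructor; exact true.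
  + intros []; auto.
  + intros U. exact Logic.I.
  + intros []; apply Z; auto.
  + intros J HJ. destruct (TE J HJ); [exists false|exists true]; auto.
  + intros [] []; split; intros H; auto using leP_refl; try contradiction; discriminate.
  + intros []; simpl; rewrite ?zeta_zeta; reflexivity.
Qed.

Definition four_points {L : pmAlg} (x y : L -> Prop) (m : four) : L -> Prop :=
  match m with px => x | py => y | pzx => zeta x | pzy => zeta y end.

Lemma component_four {L : pmAlg} (Q : (L -> Prop) -> Prop) (x y : L -> Prop)
  (ord : four -> four -> Prop) :
  (forall m n, ord m n -> ord n m -> m = n) ->
  (forall J, Q J \/ Q (zeta J) <-> J = x \/ J = y \/ J = zeta x \/ J = zeta y) ->
  (forall m n, leP (four_points x y m) (four_points x y n) <-> ord m n) ->
  iso_to Q (@Ostr four ord inv4 (@discrete four)).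
Proof.
intros Ha HQ Hle.
apply finite_iso with (M := @Ostr four ord inv4 (@discrete four))
  (e := cons px (cons py (cons pzx (cons pzy nil)))) (g := four_points x y); simpl; auto.
- constructor; exact px.
- intros []; auto.
- intros U. exact Logic.I.
- intros m. apply HQ. destruct m; auto.
- intros J HJ. apply HQ in HJ.
  destruct HJ as [->|[->|[->| ->]]]; [exists px|exists py|exists pzx|exists pzy]; reflexivity.
- intros []; simpl; rewrite ?zeta_zeta; reflexivity.
Qed.

Lemma component_two {L : pmAlg} (Q : (L -> Prop) -> Prop) (x : L -> Prop) :
  height_le1 L -> fork_closed L -> prime_ideal x -> low x ->
  (forall J, Q J \/ Q (zeta J) <-> J = x \/ J = zeta x) ->
  (forall y, lower_part x y -> y = x) -> iso_to Q Q2.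
Proof.
intros Hh Hf Px Lx HQ Sx.
(* A prime strictly above [x] exists, and [zeta x] is the only candidate. *)
assert (Hx : leP x (zeta x)).
{ destruct Lx as (C & PC & HxC & N).
  assert (TC : zeta_lower_part x C).
  { apply zeta_lower_part_comparable with x; auto; [unfold low; eauto|..].
    - left. apply lower_part_self; unfold low; eauto.
    - left; exact HxC. }
  destruct TC as [SC|SC]; apply Sx in SC.
  - congruence.
  - rewrite <- (zeta_zeta C), SC in HxC. exact HxC. }
assert (NI : ~ leP (zeta x) x) by (apply low_not_above_zeta; auto).
apply finite_iso with (M := Q2) (e := cons true (cons false nil))
  (g := fun b : bool => if b then zeta x else x); simpl.
- constructor; exact true.
- intros []; auto.
- intros U. exact Logic.I.
- intros [] []; intuition congruence.
- intros []; apply HQ; auto.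
- intros J HJ. apply HQ in HJ. destruct HJ; [exists false|exists true]; auto.
- intros [] []; split; intros H; auto using leP_refl; try contradiction.
  exfalso; intuition discriminate.
- intros []; simpl; rewrite ?zeta_zeta; reflexivity.
Qed.

Lemma component_two_lower {L : pmAlg} (Q : (L -> Prop) -> Prop) (x y : L -> Prop) :
  height_le1 L -> fork_closed L -> prime_ideal x -> low x ->
  lower_part x y -> x <> y ->
  (forall J, Q J \/ Q (zeta J) <-> J = x \/ J = y \/ J = zeta x \/ J = zeta y) ->
  iso_to Q Q3 \/ iso_to Q Q4 \/ iso_to Q Q5.
Proof.
intros Hh Hf Px Lx Sy N HQ.
pose proof (lower_part_self Px Lx) as Sx.
pose proof (@lower_part_le L x Hh) as le.
pose proof (@lower_part_zeta_le L x Hh) as zle.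
pose proof (@lower_part_not_zeta_le L x Hh) as nzle.
pose proof (@lower_part_le_zeta L x Hh Hf Px Lx) as lez.
assert (Hxy : leP x (zeta y)) by auto.
assert (Hyx : leP y (zeta x)) by auto.
assert (N1 : ~ leP x y) by (rewrite le; auto).
assert (N2 : ~ leP y x) by (rewrite le; auto).
assert (N3 : ~ leP (zeta x) (zeta y)) by (rewrite zle; auto).
assert (N4 : ~ leP (zeta y) (zeta x)) by (rewrite zle; auto).
assert (N5 : ~ leP (zeta x) x) by (apply nzle; auto).
assert (N6 : ~ leP (zeta x) y) by (apply nzle; auto).
assert (N7 : ~ leP (zeta y) x) by (apply nzle; auto).
assert (N8 : ~ leP (zeta y) y) by (apply nzle; auto).
assert (HQ' : forall J, Q J \/ Q (zeta J) <-> J = y \/ J = x \/ J = zeta y \/ J = zeta x).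
{ intros J. rewrite HQ. tauto. }
destruct (classic (leP x (zeta x))) as [Hx|Hx], (classic (leP y (zeta y))) as [Hy|Hy].
- right; right. apply component_four with x y; [|exact HQ|].
  + intros [] []; intuition congruence.
  + intros [] []; simpl; split; intros H; auto 6 using leP_refl; try contradiction;
      exfalso; intuition discriminate.
(* [Q4] has its extra comparability at [py], so here the two points exchange roles. *)
- right; left. apply component_four with y x; [|exact HQ'|].
  + intros [] []; intuition congruence.
  + intros [] []; simpl; split; intros H; auto 6 using leP_refl; try contradiction;
      exfalso; intuition discriminate.
- right; left. apply component_four with x y; [|exact HQ|].
  + intros [] []; intuition congruence.
  + intros [] []; simpl; split; intros H; auto 6 using leP_refl; try contradiction;
      exfalso; intuition discriminate.
- left. apply component_four with x y; [|exact HQ|].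
  + intros [] []; intuition congruence.
  + intros [] []; simpl; split; intros H; auto 6 using leP_refl; try contradiction;
      exfalso; intuition discriminate.
Qed.

(** * Components with at least three lower points *)

Definition subspace_open {L : pmAlg} (T : (L -> Prop) -> Prop)
  (U : {I : L -> Prop | T I} -> Prop) : Prop :=
  exists V, openP V /\ forall s, V (proj1_sig s) <-> U s.

Lemma subspace_eq {L : pmAlg} (T : (L -> Prop) -> Prop) (s t : {I : L -> Prop | T I}) :
  proj1_sig s = proj1_sig t -> s = t.
Proof.
destruct s as [I HI], t as [J HJ]; simpl. intros E. subst J.
f_equal. apply proof_irrelevance.
Qed.

(** Distinct points differ at some [a], which splits the space into two complementary open pieces;
    [sep] thus serves both separation and total disconnectedness. *)
Lemma closed_stone_space {L : pmAlg} (T : (L -> Prop) -> Prop) :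
  (forall I, T I -> prime_ideal I) -> openP (fun I => ~ T I) ->
  stone_space (@subspace_open L T).
Proof.
intros HT Tcl.
assert (sep : forall s t : {I | T I}, s <> t -> exists U V,
  @subspace_open L T U /\ @subspace_open L T V /\ U s /\ V t /\
  (forall z, U z -> V z -> False) /\ forall z, U z \/ V z).
{ intros s t N.
  assert (H : exists a, (proj1_sig s a /\ ~ proj1_sig t a) \/ (~ proj1_sig s a /\ proj1_sig t a)).
  { apply NNPP; intros Hno. apply N, subspace_eq, prop_fun_ext. intros a.
    assert (Ha := not_ex_all_not _ _ Hno a). simpl in Ha. tauto. }
  destruct H as (a & H).
  assert (O1 : @subspace_open L T (fun z : {I | T I} => proj1_sig z a)).
  { exists (fun I : L -> Prop => I a). split; [apply openP_mem|reflexivity]. }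
  assert (O2 : @subspace_open L T (fun z : {I | T I} => ~ proj1_sig z a)).
  { exists (fun I : L -> Prop => ~ I a). split; [apply openP_notmem|reflexivity]. }
  destruct H as [[Hs Ht]|[Hs Ht]].
  - exists (fun z => proj1_sig z a), (fun z => ~ proj1_sig z a).
    repeat split; auto. intros z. apply classic.
  - exists (fun z => ~ proj1_sig z a), (fun z => proj1_sig z a).
    repeat split; auto. intros z. destruct (classic (proj1_sig z a)); auto. }
split; [split; [|split; [|split]]|split; [|split]].
- exists (fun _ => True). split; [apply openP_full|tauto].
- exists (fun _ => False). split; [intros I _ []|tauto].
- intros F HF.
  (* The union runs over all open sets with trace in [F], so none has to be chosen for each member
     of [F]. *)
  exists (fun I => exists V, (openP V /\ exists U, F U /\ forall s, V (proj1_sig s) <-> U s) /\ V I).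
  split; [apply openP_union; tauto|].
  intros s. split.
  + intros (V & (HV & U & FU & E) & Vs). exists U. split; [exact FU|apply E, Vs].
  + intros (U & FU & Us). destruct (HF U FU) as (V & HV & E).
    exists V. split; [eauto|apply E, Us].
- intros U U' (V & HV & E) (V' & HV' & E'). exists (fun I => V I /\ V' I).
  split; [apply openP_and; assumption|]. intros s. rewrite E, E'. reflexivity.
- intros F HF Hcov.
  destruct (@closed_compact L T
    (fun V => openP V /\ exists U, F U /\ forall s, V (proj1_sig s) <-> U s))
    as (l & Hl & Hlcov); auto.
  + intros V [HV _]; exact HV.
  + intros I TI. destruct (Hcov (exist _ I TI)) as (U & FU & Us).
    destruct (HF U FU) as (V & HV & E). exists V. split; [eauto|].
    apply (E (exist _ I TI)), Us.
  + assert (Hl' : exists l', Forall F l' /\ forall s : {I | T I},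
      (exists V, In V l /\ V (proj1_sig s)) -> exists U, In U l' /\ U s).
    { clear Hlcov. induction Hl as [|V l (HV & U & FU & E) Hl (l' & Fl' & IH)].
      - exists nil. split; [constructor|]. intros s (V & [] & _).
      - exists (cons U l'). split; [constructor; assumption|].
        intros s (W & [<-|Wl] & Ws).
        + exists U. split; [left; reflexivity|apply E, Ws].
        + destruct (IH s) as (U' & H & H'); [eauto|]. exists U'. split; [right|]; assumption. }
    destruct Hl' as (l' & Fl' & H). exists l'. split; [exact Fl'|].
    intros s. apply H, Hlcov, (proj2_sig s).
- intros s t N. destruct (sep s t N) as (U & V & H1 & H2 & H3 & H4 & H5 & _).
  exists U, V. auto.
- intros A HA s t As At. apply NNPP; intros N. apply HA.
  destruct (sep s t N) as (U & V & H1 & H2 & H3 & H4 & H5 & H6).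
  exists U, V. split; [exact H1|split; [exact H2|]].
  split; [auto|split; [eauto|split; [eauto|]]]. intros z _. apply H5.
Qed.

Lemma component_stone {L : pmAlg} (Q : (L -> Prop) -> Prop) (x y z : L -> Prop) :
  height_le1 L -> fork_closed L -> prime_ideal x -> low x ->
  lower_part x y -> lower_part x z -> x <> y -> x <> z -> y <> z ->
  (forall J, Q J \/ Q (zeta J) <-> zeta_lower_part x J) ->
  exists (S : Type) (op : (S -> Prop) -> Prop) (I : S -> Prop),
    stone_space op /\
    (exists s1 s2 s3 : S, s1 <> s2 /\ s1 <> s3 /\ s2 <> s3) /\
    (forall s, I s -> isolated op s) /\
    iso_to Q (Q6 op I).
Proof.
intros Hh Hf Px Lx Sy Sz Nxy Nxz Nyz HQ.
pose proof (lower_part_self Px Lx) as Sx.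
assert (Scl : openP (fun I => ~ lower_part x I)).
{ apply lower_part_open_compl; auto. exists y, z. auto. }
pose (pt := exist (lower_part x)).
exists {I | lower_part x I}, (@subspace_open L (lower_part x)),
  (fun s => ~ leP (proj1_sig s) (zeta (proj1_sig s))).
split; [apply closed_stone_space; [intros I HI; apply HI|exact Scl]|split; [|split]].
- exists (pt x Sx), (pt y Sy), (pt z Sz).
  repeat split; intros E; apply (f_equal (@proj1_sig _ _)) in E; simpl in E; auto.
(* Every other point of S is below [zeta s], so this open set meets S in [s] alone. *)
- intros s Hs. exists (fun I => ~ leP I (zeta (proj1_sig s))).
  split; [apply openP_not_le|]. intros t. split; [|intros ->; exact Hs].
  intros H. apply NNPP; intros N. apply H.
  apply lower_part_le_zeta with x; auto; [apply (proj2_sig t)|apply (proj2_sig s)|].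
  intros E. apply N, subspace_eq, E.
- pose (g := fun m : {I | lower_part x I} + {I | lower_part x I} =>
    match m with inl s => proj1_sig s | inr s => zeta (proj1_sig s) end).
  assert (disj : forall s : {I | lower_part x I}, ~ lower_part x (zeta (proj1_sig s))).
  { intros s Hs. apply (lower_part_not_zeta_le Hh (proj2_sig s) Hs), leP_refl. }
  apply iso_intro with (M := Q6 _ _) (g := g); simpl.
  + constructor. left. exact (pt x Sx).
  + intros [s|s]; apply HQ; [left; apply (proj2_sig s)|right; simpl].
    rewrite zeta_zeta. apply (proj2_sig s).
  + intros I HI. apply HQ in HI. destruct HI as [SI|SI].
    * exists (inl (pt I SI)). reflexivity.
    * exists (inr (pt _ SI)). apply zeta_zeta.
  + intros [s|s] [t|t]; simpl; intros E.
    * f_equal. apply subspace_eq, E.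
    * exfalso. apply (disj t). rewrite <- E. apply (proj2_sig s).
    * exfalso. apply (disj s). rewrite E. apply (proj2_sig t).
    * f_equal. apply subspace_eq, zeta_inj, E.
  + intros [s|s] [t|t]; simpl.
    * rewrite (lower_part_le Hh (proj2_sig s) (proj2_sig t)). split.
      -- intros E. left. f_equal. apply subspace_eq, E.
      -- intros [E|(u & v & _ & E & _)]; [congruence|discriminate].
    * split.
      -- intros H. right. exists s, t. split; [reflexivity|split; [reflexivity|]].
         destruct (classic (s = t)) as [<-|N]; [right|left]; tauto.
      -- intros [E|(u & v & E & E' & H)]; [discriminate|].
         injection E as <-. injection E' as <-.
         destruct (classic (s = t)) as [<-|N]; [apply NNPP; tauto|].
         apply lower_part_le_zeta with x; auto; [apply (proj2_sig s)|apply (proj2_sig t)|].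
         intros E. apply N, subspace_eq, E.
    * split.
      -- intros H. exfalso. revert H. apply (lower_part_not_zeta_le Hh (proj2_sig s) (proj2_sig t)).
      -- intros [E|(u & v & E & _)]; discriminate.
    * rewrite (lower_part_zeta_le Hh (proj2_sig s) (proj2_sig t)). split.
      -- intros E. left. f_equal. apply subspace_eq, E.
      -- intros [E|(u & v & E & _)]; [congruence|discriminate].
  + intros [s|s]; simpl; [reflexivity|symmetry; apply zeta_zeta].
  + intros U. split.
    * intros [(V & HV & EV) (W & HW & EW)].
      (* S and its image are disjoint and closed, so cutting each piece by the complement of the
         other realises the sum topology. *)
      exists (fun I => (V I /\ ~ lower_part x (zeta I)) \/ (W (zeta I) /\ ~ lower_part x I)).
      split.
      -- apply openP_or; apply openP_and; auto.
         ++ apply (@openP_zeta L (fun I => ~ lower_part x I)), Scl.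
         ++ apply openP_zeta, HW.
      -- intros [s|s]; simpl; rewrite ?zeta_zeta; pose proof (disj s) as D;
           pose proof (proj2_sig s) as Ss; simpl in Ss;
           [rewrite <- EV|rewrite <- EW]; tauto.
    * intros (V & HV & EV). split.
      -- exists V. split; [exact HV|]. intros s. apply (EV (inl s)).
      -- exists (fun I => V (zeta I)). split; [apply openP_zeta, HV|].
         intros s. apply (EV (inr s)).
Qed.

Theorem theorem4p8 (L : pmAlg) (hL : nontrivial L) :
  inM1 L <->
  forall Q : (L -> Prop) -> Prop, order_component Q ->
    iso_to Q Q0 \/ iso_to Q Q1 \/ iso_to Q Q2 \/ iso_to Q Q3 \/
    iso_to Q Q4 \/ iso_to Q Q5 \/
    exists (S : Type) (op : (S -> Prop) -> Prop) (I : S -> Prop),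
      stone_space op /\
      (exists s1 s2 s3 : S, s1 <> s2 /\ s1 <> s3 /\ s2 <> s3) /\
      (forall s, I s -> isolated op s) /\
      iso_to Q (Q6 op I).
Proof.
rewrite inM1_iff. split.
- intros [Hh Hf] Q HQ.
  destruct (order_component_nonempty hL HQ) as (I & QI).
  assert (PI : prime_ideal I) by apply HQ, QI.
  destruct (classic (low I \/ low (zeta I))) as [H|H].
  2: { destruct (@component_isolated L Q I HQ QI) as [C|C]; tauto. }
  (* The base point may have to be [zeta I], as when [I] is maximal but not minimal. *)
  assert (Hx : exists x, prime_ideal x /\ low x /\ (Q x \/ Q (zeta x))).
  { destruct H as [H|H]; [exists I; auto|exists (zeta I)].
    rewrite zeta_zeta. auto using zeta_prime. }
  destruct Hx as (x & Px & Lx & Qx).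
  pose proof (component_lower_part Hh Hf Px Lx HQ Qx) as QE.
  pose proof (lower_part_self Px Lx) as Sx.
  destruct (classic (exists y, lower_part x y /\ x <> y)) as [(y & Sy & Nxy)|Hy].
  2: { assert (E : forall y, lower_part x y -> y = x).
       { intros y Sy. apply NNPP; intros N. apply Hy. exists y; auto. }
       right; right; left. apply component_two with x; auto.
       intros J. rewrite QE. unfold zeta_lower_part. split.
       - intros [SJ|SJ]; apply E in SJ; [auto|right]. rewrite <- SJ, zeta_zeta. reflexivity.
       - intros [->| ->]; rewrite ?zeta_zeta; auto. }
  destruct (classic (exists z, lower_part x z /\ x <> z /\ y <> z)) as [(z & Sz & Nxz & Nyz)|Hz].
  + do 6 right. apply component_stone with x y z; assumption.
  + assert (E : forall z, lower_part x z -> z = x \/ z = y).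
    { intros z Sz. apply NNPP; intros N. apply Hz. exists z. split; [exact Sz|split; intros E; apply N; auto]. }
    destruct (@component_two_lower L Q x y) as [C|[C|C]]; auto 8.
    intros J. rewrite QE. unfold zeta_lower_part. split.
    * intros [SJ|SJ]; apply E in SJ; [tauto|right; right].
      destruct SJ as [SJ|SJ]; rewrite <- SJ, zeta_zeta; auto.
    * intros [->|[->|[->| ->]]]; rewrite ?zeta_zeta; auto.
- intros H. apply order_conditions_of_iso. intros Q HQ.
  apply order_conditions_of_list.
  destruct (H Q HQ) as [C|[C|[C|[C|[C|[C|(S & op & I & _ & _ & _ & C)]]]]]]; auto 8.
  do 6 right. exists S, op, I. exact C.
Qed.
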